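(* Let $\mathcal{H}=(V,E)$ be a hypergraph in which each hyperedge $e\in E$ is equipped with a cardinality-based splitting function $\mathbf{w}_e$. Then the generalized hypergraph minimum $s$-$t$ cut problem on $\mathcal{H}$ is graph reducible if and only if $\mathbf{w}_e$ is submodular for every $e\in E$.
   Context: A hypergraph $\mathcal{H}=(V,E)$ has a finite vertex set $V$ and hyperedges $e\in E$ that are subsets of $V$. A (hyperedge) splitting function on $e$ is a function $\mathbf{w}_e:2^e\to\mathbb{R}$ with $\mathbf{w}_e(S)\ge 0$ for all $S\subseteq e$, $\mathbf{w}_e(S)=\mathbf{w}_e(e\setminus S)$ for all $S\subseteq e$ (symmetry), and $\mathbf{w}_e(e)=\mathbf{w}_e(\emptyset)=0$. It is submodular if $\mathbf{w}_e(S_1)+\mathbf{w}_e(S_2)\ge \mathbf{w}_e(S_1\cap S_2)+\mathbf{w}_e(S_1\cup S_2)$ for all $S_1,S_2\subseteq e$, and cardinality-based if $\mathbf{w}_e(S_1)=\mathbf{w}_e(S_2)$ whenever $|S_1|=|S_2|$. Given distinct $s,t\in V$, the generalized hypergraph minimum $s$-$t$ cut problem is to minimize $\mathrm{cut}_{\mathcal{H}}(S)=\sum_{e\in E}\mathbf{w}_e(e\cap S)$ over $S\subseteq V$ with $s\in S$, $t\notin S$. A hyperedge $s$-$t$ cut gadget on $e$ is a graph $G_e=(V',E')$ with $V'=e\cup\hat V$ ($\hat V$ a set of auxiliary nodes disjoint from $e$) and a set $E'$ of possibly directed edges with nonnegative weights $w_{ij}$; its gadget splitting function is $\hat{\mathbf{w}}_e(S)=\min_{T\subseteq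 V',\,T\cap e=S}\mathrm{cut}_{G_e}(T)$ for $S\subseteq e$, where $\mathrm{cut}_{G_e}(T)=\sum_{i\in T}\sum_{j\in V'\setminus T}w_{ij}$ (for directed edges only edges from $T$ to $V'\setminus T$ count). A splitting function $\mathbf{w}_e$ is modeled by the gadget if $\hat{\mathbf{w}}_e=\mathbf{w}_e$. The problem on $\mathcal{H}$ is graph reducible if every $\mathbf{w}_e$, $e\in E$, is modeled by some hyperedge $s$-$t$ cut gadget. *)

(* Defs.v *)
From HB Require Import structures.
From mathcomp Require Import all_boot all_order all_algebra.
From mathcomp Require Import reals.

Set Implicit Arguments.
Unset Strict Implicit.
Unset Printing Implicit Defensive.
Import Order.TTheory GRing.Theory Num.Theory.
Local Open Scope ring_scope.

(* A function on the subsets of [e] is a function on all of [{set V}] of which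
   only the values at [S \subset e] are ever used. *)
Section Splitting.
Variables (R : realType) (V : finType).
Implicit Types (e S : {set V}) (w : {set V} -> R).

Record splitting_function e w : Prop := SplittingFunction {
  split_ge0 : forall S, S \subset e -> 0 <= w S;
  split_sym : forall S, S \subset e -> w S = w (e :\: S);
  split_full : w e = 0;
  split_empty : w set0 = 0
}.

Definition submodular e w : Prop :=
  forall S1 S2, S1 \subset e -> S2 \subset e ->
    w (S1 :&: S2) + w (S1 :|: S2) <= w S1 + w S2.

Definition cardinality_based e w : Prop :=
  forall S1 S2, S1 \subset e -> S2 \subset e -> #|S1| = #|S2| -> w S1 = w S2.

End Splitting.

(* The node set is the disjoint union of [e] (as a subtype of [V]) and the type
   [gadget_aux] of auxiliary nodes.  The edges are given by their weights: a
   non-edge has weight 0, and an undirected edge is a pair of opposite directed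
   edges of equal weight. *)
Record gadget (R : realType) (V : finType) (e : {set V}) := Gadget {
  gadget_aux : finType;
  gadget_weight : {v : V | v \in e} + gadget_aux ->
                  {v : V | v \in e} + gadget_aux -> R;
  gadget_weight_ge0 : forall i j, 0 <= gadget_weight i j
}.

Section Gadget.
Variables (R : realType) (V : finType) (e : {set V}) (G : gadget R e).

Definition gadget_node : finType := ({v : V | v \in e} + gadget_aux G)%type.

Implicit Types (S : {set V}) (T : {set gadget_node}).

Definition gadget_cut T : R :=
  \sum_(i in T) \sum_(j in ~: T) gadget_weight i j.

(* The intersection of [T] with [e], as a set of hypergraph vertices. *)
Definition gadget_trace T : {set V} :=
  [set val x | x : {v : V | v \in e} & inl x \in T].

(* [S] seen as a set of gadget nodes: it provides the default value required by
   [arg min], and is feasible when [S \subset e] (see [gadget_trace_embed]). *)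
Definition gadget_embed S : {set gadget_node} :=
  [set inl x | x : {v : V | v \in e} & val x \in S].

Definition gadget_split S : R :=
  gadget_cut
    [arg min_(T < gadget_embed S | gadget_trace T == S) gadget_cut T]%O.

Lemma gadget_trace_embed S : S \subset e -> gadget_trace (gadget_embed S) = S.
Proof.
move=> sSe; apply/setP => v; apply/imsetP/idP => [[x]|vS].
  by rewrite inE => /imsetP[y yS [->]] ->; rewrite inE in yS.
exists (exist _ v (subsetP sSe v vS)) => //.
by rewrite inE; apply/imsetP; exists (exist _ v (subsetP sSe v vS)); rewrite ?inE.
Qed.

Lemma gadget_split_min S : S \subset e ->
  (exists2 T, gadget_trace T = S & gadget_split S = gadget_cut T) /\
  (forall T, gadget_trace T = S -> gadget_split S <= gadget_cut T).
Proof.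
move=> sSe; rewrite /gadget_split; case: arg_minP.
  by rewrite gadget_trace_embed.
move=> T /eqP TS Tmin; split; first by exists T.
by move=> T' /eqP T'S; apply: Tmin.
Qed.

Definition modeled_by (w : {set V} -> R) : Prop :=
  forall S, S \subset e -> gadget_split S = w S.

End Gadget.

(* This notion does not depend on the terminals s and t of the cut problem. *)
Definition graph_reducible (R : realType) (V : finType) (E : {set {set V}})
    (w : {set V} -> {set V} -> R) : Prop :=
  forall e, e \in E -> exists G : gadget R e, modeled_by G (w e).

(* Main.v *)
(** Cut functions of weighted digraphs are submodular, and submodularity is
    inherited by the partial minimisation defining a gadget splitting function.

    Conversely, a cardinality-based submodular [w] on an [n]-set is
    [w S = f #|S|] with [f] concave and [f 0 = f n = 0], so Green's formula for
    the discrete Laplacian gives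
      [n * f k = \sum_(0 < b < n) c_b * min (b * (n - k)) (k * (n - b))],
    with [c_b = 2 * f b - f (b - 1) - f (b + 1) >= 0].  The [b]-th term is the
    splitting function of a gadget with a single auxiliary node, receiving an
    edge of weight [n - b] from and sending one of weight [b] to each vertex
    of [e]. *)
Require Import Defs.
From mathcomp Require Import all_boot all_order all_algebra.
From mathcomp Require Import reals ring lra zify.

Set Implicit Arguments.
Unset Strict Implicit.
Unset Printing Implicit Defensive.
Import Order.TTheory GRing.Theory Num.Theory.
Local Open Scope ring_scope.

(** * Submodularity of gadget splitting functions *)

Section GadgetSubmodular.
Variables (R : realType) (V : finType) (e : {set V}) (G : gadget R e).
Implicit Types T : {set gadget_node G}.

Lemma gadget_cutE T :
  gadget_cut T = \sum_i \sum_j gadget_weight i j *+ ((i \in T) && (j \notin T)).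
Proof.
rewrite /gadget_cut big_mkcond; apply: eq_bigr => i _.
case: (i \in T) => /=; last by rewrite big1.
by rewrite big_mkcond; apply: eq_bigr => j _; rewrite inE mulrb.
Qed.

(** Checked edge by edge, over four membership bits. The sides differ only on edges between
    [T1 :\: T2] and [T2 :\: T1], in either direction, where a nonnegative weight is lost. *)
Lemma gadget_cut_submodular T1 T2 :
  gadget_cut (T1 :&: T2) + gadget_cut (T1 :|: T2)
    <= gadget_cut T1 + gadget_cut T2.
Proof.
rewrite !gadget_cutE -!big_split; apply: ler_sum => i _.
rewrite -!big_split; apply: ler_sum => j _ /=; rewrite !inE.
have := gadget_weight_ge0 i j; move: (gadget_weight i j) => x x0.
by do 4![case: (_ \in _)] => /=; rewrite ?mulr0n ?mulr1n ?addr0 ?add0r ?addr_ge0.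
Qed.

Lemma mem_gadget_trace T (x : {v : V | v \in e}) :
  (val x \in gadget_trace T) = (inl x \in T).
Proof.
by rewrite /gadget_trace mem_imset ?inE //; exact: val_inj.
Qed.

Lemma gadget_trace_sub T : gadget_trace T \subset e.
Proof. by apply/subsetP => _ /imsetP[x _ ->]; exact: valP. Qed.

Lemma gadget_trace_eq T (S : {set V}) : S \subset e ->
    (forall x : {v : V | v \in e}, (inl x \in T) = (val x \in S)) ->
  gadget_trace T = S.
Proof.
move=> sSe TS; apply/setP => v; have [ve|ve] := boolP (v \in e).
  have -> : v = val (exist (fun v => v \in e) v ve) by [].
  by rewrite mem_gadget_trace TS.
by apply/idP/idP => [/(subsetP (gadget_trace_sub T))|/(subsetP sSe)]; rewrite (negPf ve).
Qed.

Lemma gadget_traceI T1 T2 :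
  gadget_trace (T1 :&: T2) = gadget_trace T1 :&: gadget_trace T2.
Proof.
apply: gadget_trace_eq; first by rewrite subIset ?gadget_trace_sub.
by move=> x; rewrite !in_setI !mem_gadget_trace.
Qed.

Lemma gadget_traceU T1 T2 :
  gadget_trace (T1 :|: T2) = gadget_trace T1 :|: gadget_trace T2.
Proof.
apply: gadget_trace_eq; first by rewrite subUset !gadget_trace_sub.
by move=> x; rewrite !in_setU !mem_gadget_trace.
Qed.

(** Traces commute with intersection and union, so optimal node sets for [S1] and [S2] combine into
    feasible ones for [S1 :&: S2] and [S1 :|: S2]. *)
Lemma gadget_split_submodular : submodular e (gadget_split G).
Proof.
move=> S1 S2 sS1 sS2.
have [[T1 T1S ->] _] := gadget_split_min G sS1.
have [[T2 T2S ->] _] := gadget_split_min G sS2.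
have sSI : S1 :&: S2 \subset e by rewrite subIset ?sS1.
have sSU : S1 :|: S2 \subset e by rewrite subUset sS1.
apply: le_trans (gadget_cut_submodular T1 T2); apply: lerD.
  by apply: (gadget_split_min G sSI).2; rewrite gadget_traceI T1S T2S.
by apply: (gadget_split_min G sSU).2; rewrite gadget_traceU T1S T2S.
Qed.

End GadgetSubmodular.

(** * Superposition of gadgets with one auxiliary node *)

Section StarGadget.
Variables (R : realType) (V : finType) (e : {set V}) (I : finType).
Variables (p q : I -> R).
Hypotheses (p_ge0 : forall i, 0 <= p i) (q_ge0 : forall i, 0 <= q i).

(** No edge joins two auxiliary nodes, so each can be put on its cheaper side independently of the
    others. *)
Definition star_weight (u v : {v : V | v \in e} + I) : R :=
  match u, v with
  | inl _, inr i => p i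
  | inr i, inl _ => q i
  | _, _ => 0
  end.

Lemma star_weight_ge0 u v : 0 <= star_weight u v.
Proof. by case: u v => [x|i] [y|j] /=. Qed.

Definition star_gadget : gadget R e := Gadget star_weight_ge0.

Lemma star_cut (T : {set gadget_node star_gadget}) :
  gadget_cut T = \sum_i (if inr i \in T
                         then q i * (#|e| - #|gadget_trace T|)%:R
                         else p i * #|gadget_trace T|%:R).
Proof.
pose A := [set x : {v : V | v \in e} | inl x \in T].
have cardA : #|gadget_trace T| = #|A| by rewrite card_imset //; exact: val_inj.
have cardCA : (#|e| - #|A|)%N = #|~: A|.
  by rewrite [RHS]cardsCs setCK card_sig.
rewrite cardA cardCA gadget_cutE big_sumType /=.
under eq_bigr => x _.
  rewrite big_sumType /= big1 ?add0r; last by move=> y _; rewrite mul0rn.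
  over.
under [X in _ + X]eq_bigr => i _.
  rewrite big_sumType /= [X in _ + X]big1 ?addr0; last by move=> y _; rewrite mul0rn.
  over.
(* Every remaining edge has exactly one auxiliary end; both directions are regrouped by that end. *)
rewrite exchange_big -big_split; apply: eq_bigr => i _ /=.
case: (inr i \in T) => /=.
  rewrite big1 ?add0r; last by move=> x _; rewrite andbF.
  rewrite sumrMnr mulr_natr; congr (_ *+ _).
  by rewrite -sum1_card [RHS]big_mkcond; apply: eq_bigr => x _; rewrite !inE; case: (_ \in T).
rewrite [X in _ + X]big1 ?addr0 // sumrMnr mulr_natr; congr (_ *+ _).
by rewrite -sum1_card [RHS]big_mkcond; apply: eq_bigr => x _; rewrite !inE andbT; case: (_ \in T).
Qed.

End StarGadget.

(** * Green's formula, by summation by parts *)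

Section DiscreteGreen.
Variables (R : realType) (f : nat -> R).

(** Centred at [i.+1], which avoids a predecessor: this is the coefficient c_b with b = i + 1. *)
Definition neg_laplacian (i : nat) : R := f i.+1 *+ 2 - f i - f i.+2.

Lemma sum_neg_laplacian_left k :
  \sum_(0 <= i < k) neg_laplacian i * i.+1%:R
    = k.+1%:R * f k - k%:R * f k.+1 - f 0.
Proof.
elim: k => [|k IH]; first by rewrite big_geq //; ring.
by rewrite big_nat_recr //= IH /neg_laplacian; ring.
Qed.

Lemma sum_neg_laplacian k m :
  \sum_(k <= i < k + m) neg_laplacian i
    = f k.+1 - f k + f (k + m)%N - f (k + m).+1.
Proof.
elim: m => [|m IH]; first by rewrite addn0 big_geq //; ring.
by rewrite addnS big_nat_recr ?leq_addr //= IH /neg_laplacian; ring.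
Qed.

Lemma sum_neg_laplacian_right k m :
  \sum_(k <= i < k + m) neg_laplacian i * (k + m - i)%:R
    = m.+1%:R * f k.+1 - m%:R * f k - f (k + m).+1.
Proof.
elim: m => [|m IH]; first by rewrite addn0 big_geq //; ring.
(* Raising [m] adds one to every old weight; the new term has weight 1 and completes the unweighted
   sum. *)
have -> : \sum_(k <= i < k + m.+1) neg_laplacian i * (k + m.+1 - i)%:R
  = \sum_(k <= i < k + m) neg_laplacian i * (k + m - i)%:R
    + \sum_(k <= i < k + m.+1) neg_laplacian i.
  rewrite addnS !big_nat_recr ?leq_addr //= addrA -big_split /= subSnn mulr1.
  congr (_ + _); apply: eq_big_nat => i /andP[_ ltim].
  by rewrite subSn 1?ltnW // -natr1 mulrDr mulr1.
by rewrite IH sum_neg_laplacian addnS; ring.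
Qed.

(* In the sum, [i] is [b - 1], and the test [i < k] decides which of the two
   arguments of the minimum is the smaller one. *)
Lemma discrete_green n k : (k <= n)%N -> f 0 = 0 -> f n = 0 ->
  n%:R * f k = \sum_(i < n.-1) neg_laplacian i *
    (if (i < k)%N then i.+1%:R * (n - k)%:R else (n - i.+1)%:R * k%:R).
Proof.
move=> lekn f0 fn.
have [->|neqkn] := eqVneq k n.
  rewrite fn mulr0 big1 // => i _; rewrite subnn mulr0.
  by rewrite ifT ?mulr0 //; have := ltn_ord i; lia.
have ltkn : (k < n)%N by rewrite ltn_neqAle neqkn.
(* The sum runs up to [n.-1 = k + m] and is cut at [k]. *)
pose m := (n - k.+1)%N; have nE : n = (k + m).+1 by rewrite /m; lia.
rewrite -(big_mkord xpredT (fun i => neg_laplacian i *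
  (if (i < k)%N then i.+1%:R * (n - k)%:R else (n - i.+1)%:R * k%:R))) nE /=.
rewrite (big_cat_nat (n := k)) ?leq_addr //=.
have -> : ((k + m).+1 - k)%N = m.+1 by lia.
rewrite (eq_big_nat _ _ (F2 := fun i => neg_laplacian i * i.+1%:R * m.+1%:R));
  last by move=> i /andP[_ ltik]; rewrite ltik mulrA.
rewrite [X in _ + X](eq_big_nat _ _
    (F2 := fun i => neg_laplacian i * (k + m - i)%:R * k%:R));
  last by move=> i /andP[leki _]; rewrite ltnNge leki mulrA subSS.
(* The [f k.+1] terms cancel, and [f k] keeps the factor (k + 1)(m + 1) - k m = n. *)
rewrite -!mulr_suml sum_neg_laplacian_left sum_neg_laplacian_right f0 -nE fn nE.
ring.
Qed.

End DiscreteGreen.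

(** * Concavity and construction of the gadget *)

Section CardinalityBased.
Variables (R : realType) (V : finType) (e : {set V}) (w : {set V} -> R).
Hypotheses (hsplit : splitting_function e w) (hcard : cardinality_based e w).
Hypothesis hsub : submodular e w.

(** A chain of representatives, one for each size up to [#|e|], growing by one vertex at a time. *)
Definition initial_subset k : {set V} := [set x in take k (enum e)].

Definition split_of_card k : R := w (initial_subset k).

Lemma initial_subset_sub k : initial_subset k \subset e.
Proof. by apply/subsetP => x; rewrite inE => /mem_take; rewrite mem_enum. Qed.

Lemma card_initial_subset k : (k <= #|e|)%N -> #|initial_subset k| = k.
Proof.
move=> lekn; rewrite cardsE (card_uniqP _) ?take_uniq ?enum_uniq //.
by rewrite size_takel // -cardE.
Qed.

Lemma split_of_cardE (S : {set V}) : S \subset e -> w S = split_of_card #|S|.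
Proof.
move=> sSe; apply: hcard => //; first exact: initial_subset_sub.
by rewrite card_initial_subset // subset_leq_card.
Qed.

(** With S the initial subset of size i and x, y the next two vertices, submodularity at S + x and S
    + y, two sets of equal size, gives f i + f (i + 2) <= 2 f (i + 1). *)
Lemma split_of_card_concave i : (i < #|e|.-1)%N ->
  0 <= neg_laplacian split_of_card i.
Proof.
move=> ltin; have lt2 : (i.+1 < #|e|)%N by lia.
have card_k := card_initial_subset.
have [x0 _] : exists x, x \in e by apply/set0Pn; rewrite -card_gt0; lia.
pose x := nth x0 (enum e) i; pose y := nth x0 (enum e) i.+1.
have sz : (i.+1 < size (enum e))%N by rewrite -cardE.
have S1E : initial_subset i.+1 = x |: initial_subset i.
  apply/setP=> z; rewrite !inE (take_nth x0); last exact: ltnW.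
  by rewrite mem_rcons inE.
have S2E : initial_subset i.+2 = y |: initial_subset i.+1.
  by apply/setP=> z; rewrite !inE (take_nth x0) // mem_rcons inE.
(* Otherwise [initial_subset i.+2] would have only i + 1 elements. *)
have yS1 : y \notin initial_subset i.+1.
  have := card_k i.+2 lt2; rewrite S2E cardsU1 card_k 1?ltnW //.
  by case: (y \notin _) => //; lia.
have yx : y != x by apply: contraNneq yS1 => ->; rewrite S1E setU11.
have yS : y \notin initial_subset i.
  by apply: contra yS1; rewrite S1E; exact: setU1r.
have ye : y \in e by rewrite -mem_enum mem_nth.
have sub2 : y |: initial_subset i \subset e.
  by rewrite subUset sub1set ye initial_subset_sub.
have := hsub (initial_subset_sub i.+1) sub2.
have -> : initial_subset i.+1 :&: (y |: initial_subset i) = initial_subset i.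
  rewrite S1E; apply/setP => z; rewrite !in_setI !in_setU1.
  case: (z \in initial_subset i); rewrite ?orbT ?orbF //.
  by apply/andP => -[/eqP-> /eqP xy]; rewrite xy eqxx in yx.
have -> : initial_subset i.+1 :|: (y |: initial_subset i) = initial_subset i.+2.
  by rewrite S2E S1E; apply/setP => z; rewrite !in_setU !in_set1; do !case: (_ == _);
     case: (z \in _).
rewrite (split_of_cardE sub2) cardsU1 yS card_k; last by lia.
by rewrite /neg_laplacian -/(split_of_card _) add1n /split_of_card; lra.
Qed.

Lemma submodular_modeled : exists G : gadget R e, modeled_by G w.
Proof.
(* Green's formula yields n * f k, hence the division by [n]; for [n = 0] there are no auxiliary
   nodes. *)
pose n := #|e|; pose c i := neg_laplacian split_of_card i / n%:R.
pose p (i : 'I_n.-1) := c i * (n - i.+1)%:R.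
pose q (i : 'I_n.-1) := c i * i.+1%:R.
have c_ge0 (i : 'I_n.-1) : 0 <= c i.
  by rewrite divr_ge0 ?ler0n // split_of_card_concave.
have p_ge0 i : 0 <= p i by rewrite mulr_ge0 ?ler0n.
have q_ge0 i : 0 <= q i by rewrite mulr_ge0 ?ler0n.
exists (star_gadget e p_ge0 q_ge0) => S sSe; pose k := #|S|.
have lekn : (k <= n)%N by exact: subset_leq_card.
have wS : w S = \sum_(i < n.-1) (if (i < k)%N then q i * (n - k)%:R
                                 else p i * k%:R).
  have f0 : split_of_card 0 = 0.
    by rewrite -(cards0 V) -split_of_cardE ?sub0set ?(split_empty hsplit).
  have fn : split_of_card n = 0 by rewrite -split_of_cardE ?(split_full hsplit).
  have [n0|n_gt0] := posnP n.
    rewrite big1 => [|i _]; last by have := ltn_ord i; lia.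
    by rewrite split_of_cardE // -fn; congr split_of_card; lia.
  have n_neq0 : n%:R != 0 :> R by rewrite pnatr_eq0 -lt0n.
  apply: (mulfI n_neq0); rewrite split_of_cardE // (discrete_green lekn f0 fn).
  rewrite mulr_sumr; apply: eq_bigr => i _; rewrite /q /p /c.
  by case: ifP => _; field.
have [[T TS ->] Tmin] := gadget_split_min (star_gadget e p_ge0 q_ge0) sSe.
apply/eqP; rewrite eq_le; apply/andP; split; last first.
  (* Lower bound, term by term: (i + 1)(n - k) <= (n - i - 1) k exactly when i < k. *)
  rewrite wS star_cut TS -/k -/n; apply: ler_sum => i _; rewrite /p /q.
  have ltin := ltn_ord i.
  case: ifP => ik; case: ifP => _ //;
    rewrite -2!(mulrA (c i)) ler_wpM2l // -!natrM ler_nat; nia.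
(* The bound is attained by putting each auxiliary node on its cheaper side. *)
pose T0 : {set gadget_node (star_gadget e p_ge0 q_ge0)} :=
  [set u : {v : V | v \in e} + 'I_n.-1 |
    match u with inl x => val x \in S | inr i => (i < k)%N end].
have T0S : gadget_trace T0 = S by apply: gadget_trace_eq => // x; rewrite inE.
have := Tmin _ T0S.
rewrite wS [X in _ <= X -> _]star_cut T0S -/k -/n.
by under eq_bigr => i _ do rewrite inE.
Qed.

End CardinalityBased.

Theorem theorem4p6 (R : realType) (V : finType) (E : {set {set V}})
    (w : {set V} -> {set V} -> R)
    (hsplit : forall e : {set V}, e \in E -> splitting_function e (w e))
    (hcard : forall e : {set V}, e \in E -> cardinality_based e (w e)) :
  graph_reducible E w <-> (forall e : {set V}, e \in E -> submodular e (w e)).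
Proof.
split=> [red e eE S1 S2 sS1 sS2|sub e eE].
  have [G Gw] := red e eE.
  have sSI : S1 :&: S2 \subset e by rewrite subIset ?sS1.
  have sSU : S1 :|: S2 \subset e by rewrite subUset sS1.
  by rewrite -!Gw //; exact: gadget_split_submodular.
exact: (submodular_modeled (hsplit e eE) (hcard e eE) (sub e eE)).
Qed.
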